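(* For every integer $n\ge 1$, the poset $P^A_n$ is rank-symmetric, rank-unimodal and strongly Sperner, and its rank generating function is equal to that of $NC^A_n$.
   Context: Let $[n]=\{1,2,\dots,n\}$. A set partition $\pi$ of $[n]$ is noncrossing if there are no four elements $1\le a<b<c<d\le n$ such that $a,c$ lie in one block of $\pi$ and $b,d$ lie in a different block of $\pi$. $NC^A_n$ is the set of noncrossing partitions of $[n]$ ordered by refinement: $\pi\le\nu$ if each block of $\nu$ is a union of blocks of $\pi$. It is a ranked poset with rank function $\mathrm{rk}(\pi)=n-\mathrm{bk}(\pi)$, where $\mathrm{bk}(\pi)$ is the number of blocks of $\pi$. A permutation $p=p_1p_2\cdots p_n$ of $[n]$ (one-line notation) is 132-avoiding if there are no positions $1\le a<b<c\le n$ with $p_a<p_c<p_b$. Its descent set is $\mathrm{Des}(p)=\{i\in[n-1] : p_i>p_{i+1}\}$. $P^A_n$ is the poset whose elements are the 132-avoiding permutations of $[n]$, with strict order $p<q$ if and only if $\mathrm{Des}(p)\subsetneq\mathrm{Des}(q)$ (so distinct permutations with the same descent set are incomparable). It is a ranked poset with rank function $\mathrm{rk}(p)=\#\mathrm{Des}(p)$. For a finite ranked poset whose ranks run over $0,1,\dots,r$, with $w_k$ elements of rank $k$: the rank generating function is $\sum_{k=0}^r w_kx^k$; the poset is rank-symmetric if $w_k=w_{r-k}$ for all $k$; rank-unimodal if $w_0\le\cdots\le w_j\ge\cdots\ge w_r$ for some $j$; and strongly Sperner if for every $k\geq 1$ the maximum cardinality of a union of $k$ antichains equals the sum of the $k$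 largest rank sizes. *)

(* Defs.v *)
From HB Require Import structures.
From mathcomp Require Import all_boot all_order all_fingroup all_algebra.

Set Implicit Arguments.
Unset Strict Implicit.
Unset Printing Implicit Defensive.

Import Order.TTheory GRing.Theory.

(* A ranked poset is given by a finite poset [T] together with its rank
   function [rk : T -> nat]; its ranks run over 0, ..., [max_rank rk]. *)

Section RankedPoset.
Context {d : Order.disp_t} {T : finPOrderType d}.
Variable rk : T -> nat.

Definition max_rank : nat := \max_(x : T) rk x.

Definition rank_size (k : nat) : nat := #|[set x : T | rk x == k]|.

Definition rank_gen_fun : {poly int} :=
  (\sum_(k < max_rank.+1) (rank_size k)%:R *: 'X^k)%R.

Definition rank_symmetric : Prop :=
  forall k, k <= max_rank -> rank_size k = rank_size (max_rank - k).

Definition rank_unimodal : Prop :=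
  exists2 j, j <= max_rank &
    (forall i, i < j -> rank_size i <= rank_size i.+1) /\
    (forall i, j <= i < max_rank -> rank_size i.+1 <= rank_size i).

Definition antichain (A : {set T}) : bool :=
  [forall x in A, forall y in A, (x != y) ==> (x >< y)%O].

(* The antichains in the family may be empty or repeated, so that such families
   exist for every [k]. *)
Definition max_union_antichains (k : nat) : nat :=
  \max_(F : {ffun 'I_k -> {set T}} | [forall i, antichain (F i)])
     #|\bigcup_(i < k) F i|.

(* If [k] exceeds the number of ranks, this is the sum of all rank sizes. *)
Definition sum_largest_rank_sizes (k : nat) : nat :=
  sumn (take k (sort geq [seq rank_size i | i <- iota 0 max_rank.+1])).

Definition strongly_Sperner : Prop :=
  forall k, 1 <= k -> max_union_antichains k = sum_largest_rank_sizes k.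

End RankedPoset.

(* Here and below ['I_n], i.e. {0, ..., n-1}, stands for {1, ..., n}. *)

Definition noncrossing n (P : {set {set 'I_n}}) : bool :=
  ~~ [exists a : 'I_n, exists b : 'I_n, exists c : 'I_n, exists d : 'I_n,
       [&& a < b, b < c, c < d &
         [exists B in P, exists C in P,
           [&& B != C, a \in B, c \in B, b \in C & d \in C]]]].

Record NCA (n : nat) := MkNCA {
  NCA_blocks :> {set {set 'I_n}};
  _ : partition NCA_blocks [set: 'I_n] && noncrossing NCA_blocks }.

HB.instance Definition _ n := [isSub for @NCA_blocks n].
HB.instance Definition _ n := [Finite of NCA n by <:].

Definition refines (T : finType) (P Q : {set {set T}}) : bool :=
  [forall C in Q, exists S : {set {set T}}, (S \subset P) && (C == cover S)].

Lemma refinesP (T : finType) (P Q : {set {set T}}) :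
  reflect (forall C x, C \in Q -> x \in C ->
             exists2 B, B \in P & (x \in B) && (B \subset C))
          (refines P Q).
Proof.
apply: (iffP forall_inP) => [H C x /H /existsP[S /andP[SP /eqP->]]|H C CQ].
  case/bigcupP=> B BS xB; exists B; first exact: (subsetP SP).
  by rewrite xB (bigcup_sup B).
apply/existsP; exists [set B in P | B \subset C]; apply/andP; split.
  by apply/subsetP=> B; rewrite inE => /andP[].
rewrite eqEsubset; apply/andP; split.
  apply/subsetP=> x /(H _ _ CQ)[B BP /andP[xB BC]].
  by apply/bigcupP; exists B; rewrite // inE BP.
by apply/bigcupsP=> B; rewrite inE => /andP[].
Qed.

Lemma NCA_block_eq n (P : NCA n) (B C : {set 'I_n}) x :
  B \in (P : {set _}) -> C \in (P : {set _}) -> x \in B -> x \in C -> B = C.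
Proof.
move=> BP CP xB xC; have /andP[/and3P[_ /trivIsetP tr _] _] := valP P.
apply: contraTeq xC => BC; have /disjointFr := tr _ _ BP CP BC.
by move=> /(_ x xB) ->.
Qed.

Lemma NCA_refines_le n (P Q : NCA n) (B : {set 'I_n}) :
  refines P Q -> B \in (P : {set _}) ->
  exists2 C, C \in (Q : {set _}) & B \subset C.
Proof.
move=> /refinesP H BP; have /andP[/and3P[_ _ PN0] _] := valP P.
have /set0Pn[x xB] : B != set0 by apply: contraNneq PN0 => <-.
have /andP[/and3P[/eqP cQ _ _] _] := valP Q.
have : x \in cover Q by rewrite cQ.
case/bigcupP=> C CQ xC; have [B' B'P /andP[xB' sB'C]] := H _ _ CQ xC.
by exists C => //; rewrite (NCA_block_eq BP B'P xB xB').
Qed.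

Definition NCA_le n (P Q : NCA n) : bool := refines P Q.

Lemma NCA_le_refl n : reflexive (@NCA_le n).
Proof.
by move=> P; apply/refinesP=> C x CP xC; exists C; rewrite // xC subxx.
Qed.

Lemma NCA_le_trans n : transitive (@NCA_le n).
Proof.
move=> Q P R /refinesP PQ /refinesP QR; apply/refinesP=> C x CR xC.
have [D DQ /andP[xD sDC]] := QR _ _ CR xC.
have [B BP /andP[xB sBD]] := PQ _ _ DQ xD.
by exists B; rewrite // xB (subset_trans sBD).
Qed.

Lemma NCA_le_anti n : antisymmetric (@NCA_le n).
Proof.
suff sub (P Q : NCA n) : NCA_le P Q -> NCA_le Q P -> (P : {set _}) \subset Q.
  by move=> P Q /andP[PQ QP]; apply/val_inj/eqP; rewrite eqEsubset !sub.
move=> PQ QP; apply/subsetP=> B BP.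
have [C CQ sBC] := NCA_refines_le PQ BP.
have [B' B'P sCB'] := NCA_refines_le QP CQ.
have /andP[/and3P[_ _ PN0] _] := valP P.
have /set0Pn[x xB] : B != set0 by apply: contraNneq PN0 => <-.
have eqB : B = B'.
  by apply: (NCA_block_eq BP B'P xB); apply/(subsetP sCB')/(subsetP sBC).
by have -> : B = C by apply/eqP; rewrite eqEsubset sBC eqB.
Qed.

Fact NCA_display : Order.disp_t. Proof. exact: Order.Disp tt tt. Qed.

HB.instance Definition _ n := Order.Le_isPOrder.Build
  NCA_display (NCA n) (@NCA_le_refl n) (@NCA_le_anti n)
  (@NCA_le_trans n).

Definition NCA_rank n (P : NCA n) : nat := n - #|NCA_blocks P|.

Definition avoids132 n (p : 'S_n) : bool :=
  ~~ [exists a : 'I_n, exists b : 'I_n, exists c : 'I_n,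
       [&& a < b, b < c, p a < p c & p c < p b]].

Record PA (n : nat) := MkPA {
  PA_perm :> 'S_n;
  _ : avoids132 PA_perm }.

HB.instance Definition _ n := [isSub for @PA_perm n].
HB.instance Definition _ n := [Finite of PA n by <:].

(* The last position, having no successor, is never in [Des p]. *)
Definition Des n (p : 'S_n) : {set 'I_n} :=
  [set i : 'I_n | [exists j : 'I_n, (j == i.+1 :> nat) && (p j < p i)]].

Definition PA_lt n (p q : PA n) : bool := Des p \proper Des q.

Lemma PA_lt_irr n : irreflexive (@PA_lt n).
Proof. by move=> p; apply: properxx. Qed.

Lemma PA_lt_trans n : transitive (@PA_lt n).
Proof. by move=> q p r; apply: proper_trans. Qed.

Fact PA_display : Order.disp_t. Proof. exact: Order.Disp tt tt. Qed.

HB.instance Definition _ n := Order.Lt_isPOrder.Build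
  PA_display (PA n) (@PA_lt_irr n) (@PA_lt_trans n).

Definition PA_rank n (p : PA n) : nat := #|Des p|.

(* Main.v *)
(** Encode a Catalan object of size [m + 1] by a walk [0 = c_0, c_1, ..., c_m]
    in the natural numbers with [c_(i+1) <= c_i + 1], labelling a step [false]
    if it goes up by one and [true] otherwise. A 132-avoiding permutation is
    one whose Lehmer code [l] is weakly decreasing; reading [l] from the right,
    [c_i = i - l_(m-i)] is such a walk, and the steps labelled [true] are the
    descents. A partition is noncrossing iff the function [b] sending an element
    to the minimum of its block satisfies [b j <= i < j -> b j <= b i]; the
    number of open blocks, minus one, is such a walk, and the steps labelled
    [true] are those to elements which are not the minimum of their block. So
    both rank functions have the distribution of the number of letters [true].

    Splitting a walk at its first return to [0] expresses the multiset of words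
    in length [m + 1] by those in smaller lengths, through the products
    [{false, true} x W_m] and [false W_i true W_j] with [i + j + 1 = m]. A product of
    symmetric chains splits into symmetric chains, so by induction the words,
    ordered componentwise, have a symmetric chain decomposition, which lifts to
    [PA n] because strict comparison of words is strict inclusion of descent
    sets. Symmetry, unimodality and the Sperner property follow. *)
Require Import Defs.
From mathcomp Require Import all_boot all_order all_fingroup all_algebra.
From mathcomp Require Import zify.

Set Implicit Arguments.
Unset Strict Implicit.
Unset Printing Implicit Defensive.

(** * Counting walks from a given state with a prescribed word of steps *)

Fixpoint ways (w : seq bool) (s : nat) : nat :=
  if w is b :: w' then
    if b then \sum_(j < s.+1) ways w' j else ways w' s.+1
  else 1.

(** This is the sum of [f u * g v] over all factorisations [w = u ++ true :: v]; the recursion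
    stores the prefix read so far in [f]. *)
Fixpoint conv (f g : seq bool -> nat) (w : seq bool) : nat :=
  if w is b :: w' then b * (f [::] * g w') + conv (fun u => f (b :: u)) g w'
  else 0.

Lemma convE f g w :
  conv f g w = \sum_(i < size w)
    nth false w i * (f (take i w) * g (drop i.+1 w)).
Proof.
elim: w f => [|b w IH] f; first by rewrite big_ord0.
by rewrite /= big_ord_recl /= drop0 IH.
Qed.

Lemma eq_conv f f' g g' w :
    (forall u, size u < size w -> f u = f' u) ->
    (forall u, size u < size w -> g u = g' u) ->
  conv f g w = conv f' g' w.
Proof.
move=> ff' gg'; rewrite !convE; apply: eq_bigr => i _.
have := ltn_ord i => lt_i.
by rewrite ff' ?gg' // ?size_drop ?size_take ?lt_i //; lia.
Qed.

Lemma convDl f f' g w :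
  conv (fun u => f u + f' u) g w = conv f g w + conv f' g w.
Proof.
rewrite !convE -big_split; apply: eq_bigr => i _ /=.
by rewrite mulnDl mulnDr.
Qed.

Lemma convDr f g g' w :
  conv f (fun u => g u + g' u) w = conv f g w + conv f g' w.
Proof.
rewrite !convE -big_split; apply: eq_bigr => i _ /=.
by rewrite !mulnDr.
Qed.

Lemma convZl c f g w : conv (fun u => c * f u) g w = c * conv f g w.
Proof.
rewrite !convE big_distrr; apply: eq_bigr => i _ /=.
by rewrite -mulnA mulnCA.
Qed.

(** Both sides sum over the pairs of letters [true] that cut [w] into three factors. *)
Lemma convA f g h w : conv (conv f g) h w = conv f (conv g h) w.
Proof.
elim: w f => [|b w IH] f //=.
by rewrite convDl IH mul0n muln0 convZl convZl mulnA.
Qed.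

(* Split walks where they first fall below their starting state. From [s.+1]
   there is one more state to land in than from [s], namely [s], and what comes
   before the fall is a walk from [0], shifted. *)
Lemma waysS w s :
  ways w s.+1 = ways w s + conv (ways^~ 0) (ways^~ s) w.
Proof.
have [k] := ubnP (size w); elim: k w s => // k IH [|b w] s //= lt_wk.
case: b => /=.
  rewrite big_ord_recr /= mul1n mul1n IH //; congr (_ + (_ + _)).
  by apply: eq_conv => // u _; rewrite big_ord1.
rewrite add0n IH //; congr (_ + _).
(* Expanding [ways _ s.+1] in the right factor here, and [ways _ 1] in the left factor of the goal,
   gives the same terms by associativity. *)
transitivity (conv (ways^~ 0) (ways^~ s) w
              + conv (ways^~ 0) (conv (ways^~ 0) (ways^~ s)) w).
  rewrite -convDr; apply: eq_conv => // u lt_u.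
  by rewrite IH //; lia.
rewrite -convA -convDl; apply: eq_conv => // u lt_u.
by rewrite IH //; lia.
Qed.

Definition word_lt (u v : seq bool) : bool := (u != v) && all2 implb u v.

(** * Symmetric chains of words *)

Section Chains.
Variable T : eqType.

(* The hook along the first row and the last column, then the rest. *)
Fixpoint chain_prod (U V : eqType) (f : U -> V -> T) (c : seq U) (d : seq V) :
    seq (seq T) :=
  match c, d with
  | x :: c', y :: d' =>
      ([seq f x z | z <- d] ++ [seq f z (last y d') | z <- c'])
        :: chain_prod f c' (belast y d')
  | _, _ => [::]
  end.

Lemma perm_chain_prod (U V : eqType) (f : U -> V -> T) c d :
  perm_eq (flatten (chain_prod f c d)) [seq f x y | x <- c, y <- d].
Proof.
elim: c d => [|x c IH] [|y d] //; first by elim: c {IH}.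
rewrite allpairs_cons.
rewrite -[flatten _]/((([seq f x z | z <- y :: d] ++ [seq f z (last y d) | z <- c])
   ++ flatten (chain_prod f c (belast y d)))) -catA perm_cat2l.
rewrite lastI -cats1.
apply: perm_trans (_ : perm_eq _ ([seq f x0 z | x0 <- c, z <- belast y d] ++
   [seq f x0 z | x0 <- c, z <- [:: last y d]])) _.
  rewrite perm_catC; apply: perm_cat; first exact: IH.
  by rewrite allpairs1r.
by rewrite perm_sym perm_allpairs_catr.
Qed.

(** The constant [e] is the rank that [f] adds. The number [t.*2 + size h] is twice the middle rank
    of [h] plus one. It is the same for all hooks, because passing to the rest raises [i] by one and
    shortens both chains by one. *)
Lemma chain_prodP (U V : eqType) (f : U -> V -> T) (rU : rel U) (rV : rel V)
    (rT : rel T) (kU : U -> nat) (kV : V -> nat) (kT : T -> nat) e i j c d :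
    (forall x x' y, rU x x' -> rT (f x y) (f x' y)) ->
    (forall x y y', rV y y' -> rT (f x y) (f x y')) ->
    (forall x y, kT (f x y) = kU x + kV y + e) ->
    sorted rU c -> sorted rV d ->
    map kU c = iota i (size c) -> map kV d = iota j (size d) ->
  forall h, h \in chain_prod f c d ->
    sorted rT h /\ (exists2 t, t.*2 + size h = (i + j + e).*2 + size c + size d - 1
                   & map kT h = iota t (size h)).
Proof.
move=> fU fV kf; elim: c d i j => [|x c IH] [|y d] // i j sc sd kc kd h.
rewrite /= in_cons => /orP[/eqP->|]; last first.
  move=> hin; have sd' : sorted rV (belast y d).
    by move: sd; rewrite lastI -cats1 => /cat_sorted2[].
  have [] := IH (belast y d) i.+1 j _ sd' _ _ h hin.
  - exact: path_sorted sc.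
  - by case: kc.
  - move: kd; rewrite lastI -cats1 map_cat size_cat size_belast iotaD /=.
    by move/eqP; rewrite eqseq_cat ?size_map ?size_belast ?size_iota // => /andP[/eqP].
  move=> ? [t Ht kt]; split=> //; exists t => //.
  by move: Ht; rewrite size_belast; lia.
split.
  rewrite /= cat_path; apply/andP; split.
    by apply: homo_path sd => ? ?; apply: fV.
  rewrite last_map; apply: homo_path sc => ? ?; exact: fU.
exists (i + j + e).
  by rewrite /= size_cat !size_map; lia.
rewrite /= size_cat !size_map /=.
case: kc => kx kc; case: kd => ky kd.
have klast : kV (last y d) = j + size d.
  rewrite -last_map kd ky; elim: (size d) (j) => [|k IHk] j' /=; first by rewrite addn0.
  by rewrite IHk addSnnS.
rewrite kf kx ky -addnA; congr (_ :: _).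
rewrite map_cat iotaD; congr (_ ++ _).
  rewrite -map_comp.
  have -> : map (kT \o f x) d = map (addn (i + e)) (map kV d).
    by rewrite -map_comp; apply: eq_map => z /=; rewrite kf kx; lia.
  by rewrite kd -iotaDl; congr iota; lia.
rewrite -map_comp.
have -> : map (kT \o f^~ (last y d)) c = map (addn (j + size d + e)) (map kU c).
  by rewrite -map_comp; apply: eq_map => z /=; rewrite kf klast; lia.
by rewrite kc -iotaDl; congr iota; lia.
Qed.

End Chains.

(** If nonempty, such a chain occupies each of the ranks [i, ..., m - i] once. *)
Definition symchain (T : eqType) (lt : rel T) (rk : T -> nat) (m : nat)
    (c : seq T) : Prop :=
  sorted lt c /\
  exists2 i, i.*2 + size c = m.+1 & map rk c = iota i (size c).

Lemma all2_implb_refl u : all2 implb u u.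
Proof. by elim: u => //= b u ->; case: b. Qed.

Lemma all2_implb_cat u u' v v' : all2 implb u u' -> all2 implb v v' ->
  all2 implb (u ++ v) (u' ++ v').
Proof.
by elim: u u' => [|a u IH] [|a' u'] //= /andP[-> uu'] vv'; exact: IH.
Qed.

Lemma word_lt_catl a u v : word_lt u v -> word_lt (a ++ u) (a ++ v).
Proof.
case/andP=> ne uv; apply/andP; split; last exact: all2_implb_cat (all2_implb_refl _) _.
by rewrite eqseq_cat ?eqxx.
Qed.

Lemma word_lt_catr a u v : word_lt u v -> word_lt (u ++ a) (v ++ a).
Proof.
case/andP=> ne uv; apply/andP; split; last exact: all2_implb_cat _ (all2_implb_refl _).
by move: uv; rewrite all2E => /andP[/eqP sz _]; rewrite eqseq_cat // (negPf ne).
Qed.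

(** The two added letters raise the length by two and the number of letters [true] by one, so
    products of symmetric chains stay centred. *)
Definition join_words (u v : seq bool) := (false :: u) ++ (true :: v).

(** The common length [i] of the left factors fixes where [b :: w] is cut, so its multiplicity is a
    product. *)
Lemma count_mem_join_words (b : bool) w i (s t : seq (seq bool)) :
    i < size w -> {in s, forall u, size u = i} ->
  count_mem (b :: w) [seq join_words u v | u <- s, v <- t]
  = ~~ b * (nth false w i *
      (count_mem (take i w) s * count_mem (drop i.+1 w) t)).
Proof.
move=> lt_iw; elim: s => [|u s IH] szs /=; first by rewrite mul0n !muln0.
rewrite count_cat IH => [|x xs]; last by rewrite szs // in_cons xs orbT.
rewrite mulnDl !mulnDr; congr (_ + _).
have szu : size u = i by apply: szs; rewrite mem_head.
rewrite count_map.
have -> : count (preim (join_words u) (pred1 (b :: w))) t =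
    count (fun v => [&& ~~ b, nth false w i, u == take i w & v == drop i.+1 w]) t.
  apply: eq_count => v /=; rewrite /join_words /= eqseq_cons.
  rewrite -{1}[w](cat_take_drop i) eqseq_cat; last by rewrite size_take lt_iw.
  rewrite (drop_nth false lt_iw) eqseq_cons.
  by case: b IH (nth _ _ _) => [] _ [] //=; rewrite andbF.
case: b IH (nth _ _ _) => [] _ [] //=; try by rewrite ?count_pred0 ?mul0n ?muln0.
by rewrite mul1n; case: (u == _); rewrite ?mul1n // count_pred0.
Qed.

Lemma count_flatten_sum (T : eqType) (cs : seq (seq T)) (p : pred T) :
  count p (flatten cs) = \sum_(c <- cs) count p c.
Proof. by rewrite count_flatten sumnE big_map. Qed.

(** The chains cover a multiset: a word occurs once for each walk from [0] that has it. *)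
Definition words_scd m (cs : seq (seq (seq bool))) : Prop :=
  [/\ {in cs, forall c, symchain word_lt (count id) m c},
      {in flatten cs, forall w, size w = m}
    & forall w, size w = m -> count_mem w (flatten cs) = ways w 0].

Lemma symchain_prod (f : seq bool -> seq bool -> seq bool) e k l m c d :
    (forall x x' y, word_lt x x' -> word_lt (f x y) (f x' y)) ->
    (forall x y y', word_lt y y' -> word_lt (f x y) (f x y')) ->
    (forall x y, count id (f x y) = count id x + count id y + e) ->
    m = k + l + e.*2 ->
    symchain word_lt (count id) k c -> symchain word_lt (count id) l d ->
  {in chain_prod f c d, forall h, symchain word_lt (count id) m h}.
Proof.
move=> fU fV kf -> [sc [i iE ci]] [sd [j jE dj]] h hin.
have [sh [t tE th]] := chain_prodP fU fV kf sc sd ci dj hin.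
split=> //; exists t => //; rewrite tE.
have c0 : 0 < size c by case: (c) hin.
have d0 : 0 < size d by case: (c) hin => // x c'; case: (d).
lia.
Qed.

Lemma word_lt_join_l x x' y :
  word_lt x x' -> word_lt (join_words x y) (join_words x' y).
Proof. by move=> /(word_lt_catl [:: false]) /(word_lt_catr (true :: y)). Qed.

Lemma word_lt_join_r x y y' :
  word_lt y y' -> word_lt (join_words x y) (join_words x y').
Proof.
move=> /(word_lt_catl (rcons (false :: x) true)).
by rewrite !cat_rcons.
Qed.

(** A word [true :: w] has [ways w 0] walks and [false :: w] has [ways w 1], which [waysS] splits
    into [ways w 0] and a convolution. The family [A] accounts for [ways w 0] in both cases, the
    families [B i] for the convolution. *)
Lemma ex_words_scd_step m (F : nat -> seq (seq (seq bool))) :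
  (forall i, i <= m -> words_scd i (F i)) -> exists cs, words_scd m.+1 cs.
Proof.
move=> HF.
pose A := flatten [seq chain_prod cat [:: [:: false]; [:: true]] d | d <- F m].
pose B i := flatten [seq chain_prod join_words c d | c <- F i, d <- F (m - i.+1)].
have permA : perm_eq (flatten A)
    [seq u ++ w | u <- [:: [:: false]; [:: true]], w <- flatten (F m)].
  rewrite /A; elim: (F m) => [|d D IH] //.
  rewrite [flatten (d :: D)]/= [flatten (map _ _)]/= flatten_cat.
  rewrite perm_sym perm_allpairs_catr perm_sym.
  by apply: perm_cat => //; exact: perm_chain_prod.
have permB i : perm_eq (flatten (B i))
    [seq join_words u v | u <- flatten (F i), v <- flatten (F (m - i.+1))].
  rewrite /B; elim: (F i) => [|c C IH] //=.
  rewrite !flatten_cat allpairs_cat; apply: perm_cat => //.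
  elim: (F (m - i.+1)) {IH} => [|d D IH]; first by elim: (c).
  rewrite [flatten (d :: D)]/= [flatten (map _ _)]/= flatten_cat.
  rewrite perm_sym perm_allpairs_catr perm_sym.
  by apply: perm_cat => //; exact: perm_chain_prod.
exists (A ++ flatten [seq B i | i <- iota 0 m]); split.
- move=> h; rewrite mem_cat => /orP[/flatten_mapP[d dF hd]|].
    have [/(_ d dF) Hd _ _] := HF m (leqnn m).
    apply: (symchain_prod (e := 0) (k := 1) _ _ _ _ _ Hd) hd.
    + by move=> *; exact: word_lt_catr.
    + by move=> *; exact: word_lt_catl.
    + by move=> x y; rewrite count_cat addn0.
    + lia.
    + by split=> //; exists 0.
  case/flatten_mapP=> i; rewrite mem_iota add0n => lt_im.
  case/flattenP=> hs /allpairsP[[c d] /= [cF dF ->]] hd.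
  have [/(_ c cF) Hc _ _] := HF i ltac:(lia).
  have [/(_ d dF) Hd _ _] := HF (m - i.+1) ltac:(lia).
  apply: (symchain_prod (e := 1) _ _ _ _ Hc Hd) hd.
  + by move=> *; exact: word_lt_join_l.
  + by move=> *; exact: word_lt_join_r.
  + by move=> x y; rewrite count_cat /=; lia.
  + lia.
- move=> w; rewrite flatten_cat mem_cat (perm_mem permA) => /orP[].
    case/allpairsP=> [[u v] /= []].
    have [_ Hs _] := HF m (leqnn m).
    by rewrite !inE => /orP[]/eqP-> /Hs <- ->.
  case/flattenP=> c /flattenP[cs /mapP[i]].
  rewrite mem_iota add0n => lt_im -> cB wc.
  have : w \in flatten (B i) by apply/flattenP; exists c.
  rewrite (perm_mem (permB i)) => /allpairsP[[u v] /= [uF vF ->]].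
  have [_ Hu _] := HF i ltac:(lia); have [_ Hv _] := HF (m - i.+1) ltac:(lia).
  rewrite /join_words size_cat /= (Hu _ uF) (Hv _ vF); lia.
case=> [|b w] //= [szw].
have [_ _ Hm] := HF m (leqnn m).
rewrite flatten_cat count_cat (seq.permP permA) /=.
(* Each [B i] contributes the term of the convolution in which [w] is cut at position [i]. *)
have -> : count_mem (b :: w) (flatten (flatten [seq B i | i <- iota 0 m]))
    = ~~ b * conv (ways^~ 0) (ways^~ 0) w.
  rewrite convE szw big_distrr -(big_mkord xpredT (fun i => ~~ b *
    (nth false w i * (ways (take i w) 0 * ways (drop i.+1 w) 0)))) /index_iota subn0.
  have : {in iota 0 m, forall i, i < m} by move=> i; rewrite mem_iota.
  elim: (iota 0 m) => [|i s IH] si /=; first by rewrite big_nil.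
  have lt_im : i < m by apply: si; rewrite mem_head.
  rewrite flatten_cat count_cat big_cons -IH => [|j js]; last first.
    by apply: si; rewrite in_cons js orbT.
  congr (_ + _); rewrite (seq.permP (permB i)).
  have [_ Hu Hui] := HF i ltac:(lia); have [_ _ Hv] := HF (m - i.+1) ltac:(lia).
  rewrite (@count_mem_join_words b w i) ?szw // Hui ?Hv //.
    by rewrite size_drop szw.
  by rewrite size_take szw lt_im.
rewrite cats0 count_cat !count_map.
have E a : count (preim (cons a) (pred1 (b :: w))) (flatten (F m))
    = (a == b) * ways w 0.
  rewrite -(Hm w szw); case: eqP => [<-|ne].
    by rewrite mul1n; apply: eq_count => u /=; rewrite eqseq_cons eqxx.
  rewrite mul0n -(count_pred0 (flatten (F m))); apply: eq_count => u /=.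
  by rewrite eqseq_cons; case: eqP.
rewrite !E; case: b {E} => /=.
  by rewrite big_ord1 mul0n mul1n !addn0.
by rewrite waysS !mul1n mul0n addn0.
Qed.

Lemma ex_words_scd m : exists cs, words_scd m cs.
Proof.
(* The step needs decompositions for all shorter lengths, so the induction carries a choice [F] of
   them. *)
suff [F HF] : exists F, forall i, i <= m -> words_scd i (F i).
  by exists (F m); exact: HF.
elim: m => [|m [F HF]].
  exists (fun=> [:: [:: [::]]]) => i; rewrite leqn0 => /eqP->; split=> //.
  - by move=> c; rewrite inE => /eqP->; split=> //; exists 0.
  - by move=> w; rewrite inE => /eqP->.
  - by case.
have [cs Hcs] := ex_words_scd_step HF.
exists (fun i => if i <= m then F i else cs) => i le_i.
case: leqP => [/HF //|lt_mi]; suff -> : i = m.+1 by [].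
lia.
Qed.

(** * Consequences of a symmetric chain decomposition *)

(** Exchange argument on the largest entry [a]: if [Y] contains [a], remove it from both sides;
    otherwise compare [a] with the head of [Y]. *)
Lemma sumn_le_take_sorted (t Y Z : seq nat) :
  sorted geq t -> perm_eq t (Y ++ Z) -> sumn Y <= sumn (take (size Y) t).
Proof.
elim: t Y Z => [|a t IH] [|y Y] Z //=; first by move=> _ /perm_size.
move=> pt tYZ; have st := path_sorted pt.
have [aY|aNY] := boolP (a \in y :: Y).
  have := perm_to_rem aY => YE.
  have szY : size (rem a (y :: Y)) = size Y by rewrite size_rem.
  have := perm_sumn YE; rewrite [sumn (y :: Y)]/= => ->.
  rewrite [sumn (a :: _)]/= leq_add2l -szY; apply: (IH _ Z) => //.
  rewrite -(perm_cons a); apply: perm_trans tYZ _.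
  by rewrite -cat_cons -[a :: _ ++ _]cat_cons perm_cat2r.
have aZ : a \in Z.
  have : a \in (y :: Y) ++ Z by rewrite -(perm_mem tYZ) mem_head.
  by rewrite mem_cat (negPf aNY).
have /allP tle : all (geq a) t.
  by apply: order_path_min pt => ? ? ?; rewrite /geq /=; lia.
have yt : y \in t.
  have : y \in a :: t by rewrite (perm_mem tYZ) mem_head.
  rewrite in_cons => /orP[/eqP ya|//].
  by rewrite -ya mem_head in aNY.
apply: leq_add; first exact: tle.
(* The entry [y] joins the complement in place of [a]. *)
apply: (IH _ (y :: rem a Z)) => //.
apply/seq.permP => p; have /seq.permP/(_ p) := tYZ.
have /seq.permP/(_ p) := perm_to_rem aZ.
by rewrite /= !count_cat /=; lia.
Qed.

Section SymmetricChains.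
Context {d : Order.disp_t} {T : finPOrderType d}.
Variables (rk : T -> nat) (m : nat) (cs : seq (seq T)).
Hypothesis rk_lt : forall x y : T, (x < y)%O -> rk x < rk y.
Hypothesis max_rk : max_rank rk = m.
Hypothesis cs_enum : perm_eq (flatten cs) (enum T).
Hypothesis cs_chain : {in cs, forall c, symchain (<%O : rel T) rk m c}.

Lemma card_chains (A : {set T}) : #|A| = \sum_(c <- cs) count (mem A) c.
Proof.
by rewrite -count_flatten_sum (seq.permP cs_enum) cardE -size_filter enumT.
Qed.

(** A chain with ranks [i, ..., m - i] meets rank [k] exactly when [i <= minn k (m - k)]; here [i]
    is expressed through the size of the chain. *)
Lemma count_rk_symchain c k : c \in cs -> k <= m ->
  count (fun x => rk x == k) c = (m < (minn k (m - k)).*2 + size c).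
Proof.
move=> /cs_chain[_ [i iE ci]] le_km.
rewrite -(count_map rk (pred1 k)) ci count_uniq_mem ?iota_uniq // mem_iota.
congr nat_of_bool; lia.
Qed.

(** The rank size thus depends only on [minn k (m - k)], and monotonically, which gives both
    symmetry and unimodality. *)
Lemma rank_size_chains k : k <= m ->
  rank_size rk k = count (fun c : seq T => m < (minn k (m - k)).*2 + size c) cs.
Proof.
move=> le_km; rewrite /rank_size card_chains -sum1_count [RHS]big_mkcond /=.
apply: eq_big_seq => c cin; 
rewrite (eq_count (a2 := fun x => rk x == k)) => [|x /=]; last by rewrite inE.
by rewrite count_rk_symchain //; case: ifP.
Qed.

Lemma symchains_rank_symmetric : rank_symmetric rk.
Proof.
move=> k; rewrite max_rk => le_km; rewrite !rank_size_chains ?leq_subr //.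
by apply: eq_count => c; rewrite subKn // minnC.
Qed.

Lemma symchains_rank_unimodal : rank_unimodal rk.
Proof.
have mono i j : i <= m -> j <= m -> minn i (m - i) <= minn j (m - j) ->
    rank_size rk i <= rank_size rk j.
  move=> im jm le_ij; rewrite !rank_size_chains //; apply: sub_count => c /=.
  by move=> lt_m; apply: leq_trans lt_m _; rewrite leq_add2r leq_double.
exists m./2; rewrite max_rk; first by lia.
by split=> i Hi; apply: mono; lia.
Qed.

Lemma antichain_count_chain (A : {set T}) c :
  antichain A -> c \in cs -> count (mem A) c <= 1.
Proof.
move=> antiA /cs_chain[sc _]; rewrite -size_filter leqNgt; apply/negP.
have : sorted (<%O : rel T) (filter (mem A) c) by apply: sorted_filter => //; exact: Order.POrderTheory.lt_trans.
case E : (filter (mem A) c) => [|x [|y s]] //= /andP[lt_xy _] _.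
have xA : x \in A.
  have : x \in filter (mem A) c by rewrite E mem_head.
  by rewrite mem_filter => /andP[].
have yA : y \in A.
  have : y \in filter (mem A) c by rewrite E !inE eqxx orbT.
  by rewrite mem_filter => /andP[].
have /forall_inP/(_ _ xA)/forall_inP/(_ _ yA) := antiA.
by rewrite Order.POrderTheory.lt_eqF //= Order.POrderTheory.lt_comparable.
Qed.

Lemma sum_rank_size J : uniq J ->
  \sum_(j <- J) rank_size rk j = #|[set x | rk x \in J]|.
Proof.
move=> uJ; rewrite -sum1_card.
under eq_bigr => j _ do rewrite /rank_size -sum1_card big_mkcond.
rewrite exchange_big [RHS]big_mkcond; apply: eq_bigr => x _ /=.
under eq_bigr => j _ do rewrite inE.
rewrite inE -big_mkcond sum1_count.
rewrite (eq_count (a2 := pred1 (rk x))) => [|j /=]; last by rewrite eq_sym.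
by rewrite count_uniq_mem //; case: ifP.
Qed.

Lemma size_symchain_le c : c \in cs -> size c <= m.+1.
Proof. by move=> /cs_chain[_ [i]]; lia. Qed.

(** Each of the [k] antichains meets a chain at most once. *)
Lemma symchains_antichains_le k (F : 'I_k -> {set T}) :
  (forall i, antichain (F i)) ->
  #|\bigcup_(i < k) F i| <= \sum_(c <- cs) minn k (size c).
Proof.
move=> antiF; rewrite card_chains big_seq [leqRHS]big_seq.
apply: leq_sum => c cin; rewrite leq_min count_size andbT.
apply: leq_trans (_ : \sum_(i < k) count (mem (F i)) c <= _); last first.
  rewrite -[leqRHS]card_ord -sum1_card; apply: leq_sum => i _.
  exact: antichain_count_chain.
elim: c {cin} => [|x c IH] //=.
rewrite big_split /=; apply: leq_add => //.
have [/bigcupP[i _ xi]|//] := boolP (x \in _).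
by rewrite (bigD1 i) //= xi.
Qed.

(* The [k] middle ranks meet every symmetric chain in as many elements as
   possible. *)
Lemma symchains_middle_ranks k : k <= m.+1 ->
  \sum_(c <- cs) minn k (size c)
  = \sum_(j <- iota ((m.+1 - k)./2) k) rank_size rk j.
Proof.
move=> le_km; rewrite sum_rank_size ?iota_uniq // card_chains.
apply: eq_big_seq => c cin.
rewrite (eq_count (a2 := preim rk (mem (iota (m.+1 - k)./2 k)))) => [|x /=]; last first.
  by rewrite inE.
rewrite -(count_map rk (mem (iota _ k))).
have [_ [i iE ->]] := cs_chain cin.
rewrite -size_filter.
have : perm_eq [seq x <- iota i (size c) | x \in iota (m.+1 - k)./2 k]
    (iota (maxn i (m.+1 - k)./2) (minn k (size c))).
  apply: uniq_perm; rewrite ?filter_uniq ?iota_uniq // => x.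
  by rewrite mem_filter !mem_iota; lia.
by move/perm_size->; rewrite size_iota.
Qed.

Lemma symchains_strongly_Sperner : strongly_Sperner rk.
Proof.
move=> k k_ge1; apply/eqP; rewrite eqn_leq; apply/andP; split.
  apply/bigmax_leqP => F /forallP antiF.
  apply: leq_trans (symchains_antichains_le antiF) _.
  (* There are only [m.+1] ranks and no chain is longer, so [k] may be capped. *)
  have -> : \sum_(c <- cs) minn k (size c)
      = \sum_(c <- cs) minn (minn k m.+1) (size c).
    by apply: eq_big_seq => c /size_symchain_le/minn_idPr szc; rewrite -minnA szc.
  set k' := minn k m.+1.
  rewrite symchains_middle_ranks ?geq_minr // /sum_largest_rank_sizes max_rk.
  set s := sort _ _; have szs : size s = m.+1 by rewrite size_sort size_map size_iota.
  have -> : take k s = take k' s.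
    by rewrite /k' /minn; case: ltnP => // le_mk; rewrite !take_oversize ?szs.
  (* The middle ranks start at [a]; being one choice of [k'] ranks, they have at most the total size
     of the [k'] largest. *)
  pose a := (m.+1 - k')./2.
  have := @sumn_le_take_sorted s (map (rank_size rk) (iota a k'))
    (map (rank_size rk) (iota 0 a ++ iota (a + k') (m.+1 - (a + k')))).
  rewrite size_map size_iota sumnE big_map; apply.
    by apply: sort_sorted => x y; rewrite /geq /=; lia.
  rewrite /s (perm_trans (permEl (perm_sort _ _))) // -map_cat; apply: perm_map.
  rewrite perm_sym perm_catCA -{2}[a]add0n -iotaD -iotaD.
  by rewrite (_ : _ + _ = m.+1) // /a /k'; lia.
(* Conversely, the rank levels are themselves antichains. The list [J] holds the indices of the [k]
   largest ranks, or all indices if there are fewer. *)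
rewrite /sum_largest_rank_sizes max_rk sort_map -map_take.
set J := take k _; have uJ : uniq J by rewrite take_uniq // sort_uniq iota_uniq.
(* Indices beyond the end of [J] give the empty antichain. *)
pose F := [ffun i : 'I_k => [set x | (i < size J) && (rk x == nth 0 J i)]].
have antiF : [forall i, antichain (F i)].
  apply/forallP => i; apply/forall_inP => x; rewrite ffunE inE => /andP[_ /eqP rx].
  apply/forall_inP => y; rewrite inE => /andP[_ /eqP ry]; apply/implyP => ne_xy.
  apply/negP; rewrite /Order.comparable !Order.POrderTheory.le_eqVlt.
  by rewrite (negPf ne_xy) eq_sym (negPf ne_xy) => /orP[]/rk_lt; rewrite rx ry ltnn.
rewrite sumnE big_map sum_rank_size //.
apply: leq_trans (leq_bigmax_cond _ antiF); apply: subset_leq_card.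
apply/subsetP => x; rewrite inE => xJ.
have lt_iJ : index (rk x) J < size J by rewrite index_mem.
have lt_ik : index (rk x) J < k.
  by apply: leq_trans lt_iJ _; rewrite /J size_take; case: ifP => //; lia.
apply/bigcupP; exists (Ordinal lt_ik) => //.
by rewrite ffunE inE lt_iJ nth_index /=.
Qed.

End SymmetricChains.

(** * Transfer from words to posets whose elements carry words *)

Lemma ways_gt0 w s : 0 < ways w s.
Proof.
elim: w s => //= b w IH s; case: b => //.
by rewrite big_ord_recl addn_gt0 IH.
Qed.

(** A rearrangement of the images is given by a permutation of the positions, which also rearranges
    [s]. *)
Lemma perm_eq_map_lift (T : Type) (U : eqType) (f : T -> U) (s : seq T) (u : seq U) :
  perm_eq (map f s) u -> exists2 t, map f t = u & forall p, count p t = count p s.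
Proof.
case: s => [|x0 s].
  by rewrite perm_sym => /perm_nilP->; exists [::].
set xs := x0 :: s; rewrite perm_sym => /(perm_iotaP (f x0))[Is HI ->].
exists (map (nth x0 xs) Is).
  rewrite -map_comp; apply/eq_in_map => i iI; rewrite [LHS]/= (nth_map x0) //.
  by have := perm_mem HI i; rewrite iI mem_iota size_map => /esym.
move=> p; rewrite count_map (seq.permP HI) size_map -count_map.
by rewrite map_nth_iota0 // take_size.
Qed.

Section WordStatistic.
Context {d : Order.disp_t} {T : finPOrderType d}.
Variables (m : nat) (D : T -> seq bool) (rk : T -> nat).
Hypothesis size_D : forall x, size (D x) = m.
Hypothesis card_D : forall w, size w = m -> #|[set x | D x == w]| = ways w 0.
Hypothesis rk_D : forall x, rk x = count id (D x).

Lemma word_max_rank : max_rank rk = m.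
Proof.
apply/eqP; rewrite eqn_leq; apply/andP; split.
  by apply/bigmax_leqP => x _; rewrite rk_D -[leqRHS](size_D x) count_size.
(* The top rank is attained because the word with all letters [true] belongs to some walk. *)
have szn : size (nseq m true) = m by rewrite size_nseq.
have /card_gt0P[x] : 0 < #|[set x | D x == nseq m true]|.
  by rewrite card_D // ways_gt0.
rewrite inE => /eqP Dx; apply: leq_trans (leq_bigmax x).
by rewrite rk_D Dx count_nseq mul1n.
Qed.

(** The right side involves only [m] and [k], so any two such posets have equal rank sizes. *)
Lemma word_rank_size k :
  rank_size rk k = \sum_(w : m.-tuple bool | count id w == k) ways w 0.
Proof.
pose Dt x : m.-tuple bool := tcast (size_D x) (in_tuple (D x)).
have DtE x : Dt x = D x :> seq bool by rewrite val_tcast.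
rewrite /rank_size -sum1dep_card (partition_big Dt (fun w => count id w == k)) /=.
  apply: eq_bigr => w /eqP wk; rewrite sum1dep_card -card_D ?size_tuple //.
  congr #|pred_of_set _|; apply/setP => x.
  rewrite !inE -val_eqE /= DtE rk_D.
  by case: (D x =P w) => [->|_]; rewrite ?andbF // wk eqxx.
by move=> x /eqP <-; rewrite DtE rk_D.
Qed.

Hypothesis D_lt : forall x y, word_lt (D x) (D y) -> (x < y)%O.

(** The words of the elements rearrange the chains of words. The rearrangement is lifted to the
    elements and cut into pieces of the same lengths, and [D_lt] makes each piece a chain. *)
Lemma ex_symchains : exists2 cs : seq (seq T), perm_eq (flatten cs) (enum T)
  & {in cs, forall c, symchain (<%O : rel T) rk m c}.
Proof.
have [ws [ws_chain ws_size ws_count]] := ex_words_scd m.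
have : perm_eq (map D (enum T)) (flatten ws).
  apply/allP => w; rewrite mem_cat => w_in.
  have szw : size w = m.
    by case/orP: w_in => [/mapP[x _ ->]|/ws_size].
  rewrite /= ws_count // -card_D // count_map cardE -size_filter enumT.
  by apply/eqP; congr size; apply: eq_filter => x; rewrite /= inE.
case/perm_eq_map_lift => t Dt count_t.
pose cs := reshape (shape ws) t.
have szt : size t = sumn (shape ws).
  by rewrite -(size_map D) Dt size_flatten.
have Dcs : map (map D) cs = ws by rewrite map_reshape Dt flattenK.
exists cs; first by rewrite reshapeKr ?szt //; apply/seq.permP.
move=> c c_in.
have [sc [i iE kc]] : symchain word_lt (count id) m (map D c).
  by apply: ws_chain; rewrite -Dcs; apply: map_f.
rewrite size_map in iE kc; split; last first.
  by exists i => //; rewrite -kc -map_comp; apply: eq_map => x /=; rewrite rk_D.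
by move: sc; rewrite sorted_map; apply: sub_sorted => x y; exact: D_lt.
Qed.
End WordStatistic.

(** * Counting codes by their words *)

Section GeneratingTree.
(* A list lists the successive choices with the latest one first. *)
Variables (ok letter : seq nat -> pred nat) (state : seq nat -> nat).

Fixpoint tree_node (r : seq nat) : bool :=
  if r is v :: r' then [&& v <= size r', ok r' v & tree_node r'] else true.

(** The first choice is forced to be [0] and gives no letter, so a code of size [m.+1] has a word of
    length [m], latest letter first. *)
Fixpoint node_word (r : seq nat) : seq bool :=
  if r is v :: r' then if r' is [::] then [::] else letter r' v :: node_word r'
  else [::].

Definition children (r : seq nat) (b : bool) : seq nat :=
  [seq v <- iota 0 (size r).+1 | ok r v & letter r v == b].

Fixpoint nodes (w : seq bool) : seq (seq nat) :=
  if w is b :: w' then [seq v :: r | r <- nodes w', v <- children r b]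
  else [:: [:: 0]].

Hypothesis ok0 : ok [::] 0.
Hypothesis state0 : state [:: 0] = 0.
(** From any node, the states move exactly as the walks counted by [ways]. *)
Hypothesis state_children : forall r b, r != [::] -> tree_node r ->
  perm_eq [seq state (v :: r) | v <- children r b]
          (if b then iota 0 (state r).+1 else [:: (state r).+1]).

Lemma size_node_word r : size (node_word r) = (size r).-1.
Proof. by elim: r => //= v [|v' r] //= ->. Qed.

Lemma mem_nodes w r : reflect
  [/\ size r = (size w).+1, tree_node r & node_word r = w] (r \in nodes w).
Proof.
elim: w r => [|b w IH] r /=.
  rewrite inE; apply: (iffP eqP) => [->|]; first by rewrite /= ok0.
  by case: r => [|v [|? ?]] // [] //= _; rewrite leqn0 => /andP[/eqP->].
apply: (iffP allpairsPdep) => [[r' [v [/IH[szr tr wr] vc ->]]]|].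
  move: vc; rewrite mem_filter mem_iota add0n ltnS /= => /andP[/andP[okv /eqP lv] vr].
  rewrite /= tr okv vr szr -wr; split=> //.
  by case: r' szr lv {tr wr okv vr} => // ? ? _ ->.
case: r => [|v r] [] //= [szr] /and3P[vr okv tr].
case: r szr tr vr okv => // v' r szr tr vr okv [lb wr].
exists (v' :: r), v; split=> //; first exact/IH.
by rewrite mem_filter lb eqxx okv mem_iota.
Qed.

Lemma uniq_nodes w : uniq (nodes w).
Proof.
elim: w => //= b w IH; apply: allpairs_uniq_dep => //.
- by move=> r _; rewrite filter_uniq ?iota_uniq.
- by move=> [r v] [r' v'] _ _ /= [-> ->].
Qed.

(** Both sides count walks reading [rev u] and then [w]; the part along [u] is replaced by nodes.
    [state_children] moves one letter across. *)
Lemma sum_ways_nodes u w :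
  \sum_(r <- nodes u) ways w (state r) = ways (catrev u w) 0.
Proof.
elim: u w => [|b u IH] w; first by rewrite /= big_seq1 state0.
rewrite big_allpairs_dep /= -IH; apply: eq_big_seq => r /mem_nodes[szr tr _].
rewrite -(big_map (fun v => state (v :: r)) xpredT (ways w)).
have r0 : r != [::] by rewrite -size_eq0 szr.
rewrite (perm_big _ (state_children b r0 tr)); case: b => /=.
  by rewrite -(big_mkord xpredT (ways w)) /index_iota subn0.
by rewrite big_seq1.
Qed.

Lemma size_nodes u : size (nodes u) = ways (rev u) 0.
Proof. by rewrite /rev -sum_ways_nodes /= sum1_size. Qed.

Lemma card_node_word (T : finType) m (f : T -> seq nat) w :
    injective f -> (forall x, size (f x) = m.+1 /\ tree_node (f x)) ->
    (forall r, size r = m.+1 -> tree_node r -> exists x, f x = r) ->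
    size w = m ->
  #|[set x | rev (node_word (f x)) == w]| = ways w 0.
Proof.
move=> f_inj f_tree f_surj szw; rewrite -[w in RHS]revK -size_nodes cardE.
rewrite -(size_map f); apply: perm_size; apply: uniq_perm.
- by rewrite map_inj_uniq ?enum_uniq.
- exact: uniq_nodes.
move=> r; apply/mapP/mem_nodes => [[x]|[]].
  rewrite mem_enum inE => /eqP <- ->; have [szx tx] := f_tree x.
  by rewrite revK size_node_word szx.
rewrite size_rev szw => szr tr wr; have [x fx] := f_surj r szr tr.
by exists x => //; rewrite mem_enum inE fx wr revK.
Qed.

End GeneratingTree.

(** * The generating trees of weakly decreasing codes and of block minima *)

Definition asc_ok (r : seq nat) (v : nat) : bool := head 0 r <= v.
Definition asc_letter (r : seq nat) (v : nat) : bool := head 0 r < v.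
(** Lehmer codes grow from the right, so the head is the latest entry and this is [c_i] for
    [i = (size r).-1]. *)
Definition asc_state (r : seq nat) : nat := (size r).-1 - head 0 r.

Lemma asc_state_children r b : r != [::] -> tree_node asc_ok r ->
  perm_eq [seq asc_state (v :: r) | v <- children asc_ok asc_letter r b]
          (if b then iota 0 (asc_state r).+1 else [:: (asc_state r).+1]).
Proof.
case: r => [|a r] // _ /and3P[le_a _ _]; apply: uniq_perm.
- rewrite map_inj_in_uniq ?filter_uniq ?iota_uniq // => v v'.
  rewrite !mem_filter !mem_iota /asc_state /=; lia.
- by case: b; rewrite ?iota_uniq.
move=> s; apply/mapP/idP => [[v]|].
  rewrite mem_filter mem_iota /asc_ok /asc_letter /asc_state /= => Hv ->.
  by case: b Hv; rewrite ?eqb_id ?eqbF_neg /= !inE ?mem_iota; lia.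
(* Adding [v] leads to state [(size r).+1 - v]; solve for [v]. *)
move=> Hs; exists ((size r).+1 - s).
  rewrite mem_filter mem_iota /asc_ok /asc_letter /=; move: Hs.
  by case: b; rewrite ?eqb_id ?eqbF_neg /= !inE ?mem_iota /asc_state /=; lia.
move: Hs; rewrite /asc_state /=.
by case: b; rewrite /= !inE ?mem_iota; lia.
Qed.

(* [r] lists, from the latest element down, the block minima of the elements
   below [size r]; [v] is [size r] or the minimum of a block still open. *)
Definition nest_ok (r : seq nat) (v : nat) : bool :=
  all (leq v) (take (size r - v) r).
Definition nest_letter (r : seq nat) (v : nat) : bool := v < size r.
Definition nest_stack (r : seq nat) : seq nat :=
  [seq v <- iota 0 (size r) | nest_ok r v].
Definition nest_state (r : seq nat) : nat := (size (nest_stack r)).-1.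

(** Applied to the open blocks: joining the one at position [i] leaves [i + 1] open, hence state
    [i]. *)
Lemma map_count_leq_sorted s : sorted ltn s ->
  [seq (count (geq v) s).-1 | v <- s] = iota 0 (size s).
Proof.
elim: s => // a s IH /= pas.
have /allP lt_a : all (ltn a) s by apply: order_path_min pas; exact: ltn_trans.
rewrite leqnn add1n /=; congr (_ :: _).
  rewrite -(count_pred0 s); apply: eq_in_count => v /lt_a /=; lia.
rewrite (iotaDl 1 0) -IH ?(path_sorted pas) // -map_comp.
apply/eq_in_map => v vs /=; rewrite (ltnW (lt_a v vs)) add1n /=.
have : has (geq v) s by apply/hasP; exists v => //=.
by rewrite has_count; lia.
Qed.

(** An element with block minimum [v] closes the open blocks of larger minimum. It opens a block of
    its own exactly when [v = size r]. *)
Lemma nest_stack_cons r v : v <= size r ->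
  nest_stack (v :: r) = [seq x <- rcons (nest_stack r) (size r) | x <= v].
Proof.
move=> le_v; rewrite /nest_stack -cats1 filter_cat -filter_predI.
rewrite -[size (v :: r)]/((size r).+1) -[(size r).+1]addn1 iotaD filter_cat add0n; congr (_ ++ _).
  apply: eq_in_filter => x; rewrite mem_iota add0n => lt_x.
  by rewrite /nest_ok /= subSn ?(ltnW lt_x).
suff -> : [seq x <- iota (size r) 1 | nest_ok (v :: r) x]
    = [seq x <- [:: size r] | x <= v] by [].
by rewrite /= /nest_ok /= subSnn /= take0 /= andbT.
Qed.

Lemma nest_state_children r b : r != [::] -> tree_node nest_ok r ->
  perm_eq [seq nest_state (v :: r) | v <- children nest_ok nest_letter r b]
          (if b then iota 0 (nest_state r).+1 else [:: (nest_state r).+1]).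
Proof.
move=> r0 _.
(* The block of [0] is always open, so the predecessor in [nest_state] does not truncate. *)
have stack_gt0 : 0 < size (nest_stack r).
  rewrite size_filter -has_count; apply/hasP; exists 0.
    by rewrite mem_iota lt0n size_eq0.
  by apply/allP.
have stack_lt : {in nest_stack r, forall x, x < size r}.
  by move=> x; rewrite mem_filter mem_iota => /andP[].
have stateE v : v <= size r -> nest_state (v :: r) =
    (count (geq v) (nest_stack r) + (size r <= v)).-1.
  by move=> le_v; rewrite /nest_state nest_stack_cons // size_filter -cats1 count_cat /= addn0.
case: b.
  have -> : children nest_ok nest_letter r true = nest_stack r.
    rewrite /children -[(size r).+1]addn1 iotaD filter_cat /= /nest_letter add0n ltnn.
    rewrite andbF cats0; apply: eq_in_filter => x; rewrite mem_iota add0n.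
    by case/andP=> _ ->; rewrite andbT.
  rewrite prednK // -map_count_leq_sorted; last first.
    by apply: sorted_filter; [exact: ltn_trans | exact: iota_ltn_sorted].
  suff -> : [seq nest_state (v :: r) | v <- nest_stack r] =
      [seq (count (geq v) (nest_stack r)).-1 | v <- nest_stack r] by [].
  apply/eq_in_map => v /stack_lt lt_v.
  by rewrite stateE ?(ltnW lt_v) // leqNgt lt_v addn0.
have -> : children nest_ok nest_letter r false = [:: size r].
  rewrite /children -[(size r).+1]addn1 iotaD filter_cat /= /nest_letter add0n ltnn.
  rewrite /nest_ok subnn take0 /=.
  rewrite (eq_in_filter (a2 := pred0)) ?filter_pred0 // => x.
  by rewrite mem_iota add0n; case/andP=> _ ->; rewrite andbF.
rewrite /= stateE // leqnn addn1 /= prednK //.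
suff -> : count (geq (size r)) (nest_stack r) = size (nest_stack r) by [].
by apply/eqP; rewrite -all_count; apply/allP => x /stack_lt /ltnW.
Qed.

(** * 132-avoiding permutations *)

Lemma nth_node_word letter r i : i.+1 < size r ->
  nth false (node_word letter r) i = letter (drop i.+1 r) (nth 0 r i).
Proof.
by elim: r i => // v [|v' r] IH [|i] // lt_i; exact: (IH i).
Qed.

Lemma tree_nodeP (ok : seq nat -> pred nat) r : reflect
  (forall i, i < size r -> nth 0 r i <= size r - i.+1 /\ ok (drop i.+1 r) (nth 0 r i))
  (tree_node ok r).
Proof.
elim: r => [|v r IH]; first by left.
apply: (iffP and3P) => [[vr okv /IH tr] [_|i /tr //]|tr].
  by rewrite /= subn1 drop0.
have [] := tr 0 isT; rewrite /= subn1 drop0 => vr okv; split=> //.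
by apply/IH => i lt_i; apply: (tr i.+1).
Qed.

(** These are all candidates for Lehmer codes, listed so that they can be counted against the
    permutations. *)
Fixpoint bounded_codes n : seq (seq nat) :=
  if n is n'.+1 then [seq v :: r | r <- bounded_codes n', v <- iota 0 n]
  else [:: [::]].

Lemma size_bounded_codes n : size (bounded_codes n) = n`!.
Proof.
by elim: n => // n IH; rewrite size_allpairs IH size_iota factS mulnC.
Qed.

Lemma mem_bounded_codes n r :
  (r \in bounded_codes n) = (size r == n) && tree_node (fun _ => xpredT) r.
Proof.
elim: n r => [|n IH] [|v r]; rewrite ?inE //.
  by apply/negP => /allpairsP[[]] ? ? [].
apply/allpairsP/idP => [[[r' v'] [r'_in v'_in [-> ->]]]|].
  move: r'_in v'_in; rewrite IH mem_iota => /andP[/eqP <- tr'] /andP[_ le_v'].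
  by apply/and4P; split=> //=.
move=> /and4P[/eqP[szr] vr _ tr]; exists (r, v).
split=> //; first by rewrite IH szr eqxx.
by rewrite -[n.+1]/(0 + n.+1) mem_iota /= add0n ltnS -szr.
Qed.

Section Lehmer.
Variable n : nat.
Implicit Types (p q : 'S_n) (i j : 'I_n).

Definition lehmer_set p i : {set 'I_n} := [set j : 'I_n | (i < j) && (p j < p i)].
Definition lehmer p : seq nat := [seq #|lehmer_set p i| | i <- enum 'I_n].

Lemma size_lehmer p : size (lehmer p) = n.
Proof. by rewrite size_map size_enum_ord. Qed.

Lemma nth_lehmer p i : nth 0 (lehmer p) i = #|lehmer_set p i|.
Proof. by rewrite (nth_map i) ?size_enum_ord // nth_ord_enum. Qed.

Lemma lehmer_le p i : #|lehmer_set p i| <= n - i.+1.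
Proof.
apply: leq_trans (_ : #|[set j : 'I_n | i < j]| <= _).
  by apply/subset_leq_card/subsetP => j; rewrite !inE => /andP[].
by rewrite -sum1dep_card -(big_geq_mkord _ _ xpredT (fun=> 1)) sum_nat_const_nat muln1.
Qed.

(** The values [p j] with [j = i] or [j] in [lehmer_set p i] are all below [q i]. In [q] they stand
    after [i], since [q] agrees with [p] before [i]. The element [i] itself makes the inequality
    strict. *)
Lemma lehmer_ltn p q i :
  (forall j, j < i -> p j = q j) -> p i < q i ->
  #|lehmer_set p i| < #|lehmer_set q i|.
Proof.
move=> eq_pq lt_i; have iN : i \notin lehmer_set p i by rewrite inE ltnn.
have <- : #|i |: lehmer_set p i| = #|lehmer_set p i|.+1 by rewrite cardsU1 iN.
rewrite -[leqLHS](card_imset _ (@perm_inj _ (p * q^-1)%g)).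
apply/subset_leq_card/subsetP => k /imsetP[j j_in k_def].
have qk : q k = p j by rewrite k_def permM permKV.
have [le_ij le_p] : i <= j /\ p j <= p i.
  by move: j_in; rewrite !inE => /orP[/eqP->|/andP[/ltnW ? /ltnW]].
rewrite inE qk (leq_ltn_trans le_p lt_i) andbT ltnNge leq_eqVlt.
apply/negP => /orP[/eqP/val_inj ki|lt_ki].
  by rewrite ki in qk; rewrite qk ltnNge le_p in lt_i.
have : p k = p j by rewrite -qk eq_pq.
by move/perm_inj => kj; rewrite kj ltnNge le_ij in lt_ki.
Qed.

Lemma lehmer_inj : injective lehmer.
Proof.
move=> p q eq_c; apply/permP => i.
have [k] := ubnP i; elim: k i => // k IH i lt_ik.
have eq_lt j : j < i -> p j = q j by move=> lt_ji; apply: IH; lia.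
have eq_i : #|lehmer_set p i| = #|lehmer_set q i|.
  by rewrite -!nth_lehmer eq_c.
apply/val_inj/eqP; case: (ltngtP (p i) (q i)) => // [/(lehmer_ltn eq_lt)|].
  by rewrite eq_i ltnn.
by move/lehmer_ltn; rewrite eq_i ltnn => ->// j /eq_lt.
Qed.

(** An injection of the [n]! permutations into the [n]! bounded codes is onto. *)
Lemma lehmer_surj r : size r = n -> tree_node (fun _ => xpredT) r ->
  exists p, lehmer p = r.
Proof.
move=> szr tr; have : r \in bounded_codes n by rewrite mem_bounded_codes szr eqxx.
have us : uniq (map lehmer (enum 'S_n)).
  by rewrite map_inj_uniq ?enum_uniq //; exact: lehmer_inj.
have sub : {subset map lehmer (enum 'S_n) <= bounded_codes n}.
  move=> c /mapP[p _ ->]; rewrite mem_bounded_codes size_lehmer eqxx.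
  apply/tree_nodeP => i; rewrite size_lehmer => lt_i; split=> //.
  by rewrite (nth_lehmer p (Ordinal lt_i)) (lehmer_le p (Ordinal lt_i)).
have [|_ <-] := uniq_min_size us sub.
  by rewrite size_bounded_codes size_map -cardE card_Sn.
by case/mapP => p _ ->; exists p.
Qed.

Lemma avoids132P p : reflect
  (forall a b c : 'I_n, a < b -> b < c -> p a < p c -> p c < p b -> False)
  (avoids132 p).
Proof.
apply: (iffP idP) => [/existsPn av a b c ab bc ac cb|av].
  have /existsPn/(_ b)/existsPn/(_ c) := av a.
  by rewrite ab bc ac cb.
apply/existsPn => a; apply/existsPn => b; apply/existsPn => c.
by apply/and4P => -[]; exact: av.
Qed.

Lemma lehmer_set_descent p i j : j = i.+1 :> nat -> p j < p i ->
  #|lehmer_set p j| < #|lehmer_set p i|.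
Proof.
move=> ji lt_p; apply/proper_card/properP; split.
  by apply/subsetP => k; rewrite !inE; lia.
by exists j; rewrite !inE ?ltnn // lt_p ji ltnSn.
Qed.

Lemma lehmer_set_ascent p i j : j = i.+1 :> nat -> p i < p j ->
  lehmer_set p i \subset lehmer_set p j.
Proof.
move=> ji lt_p; apply/subsetP => k; rewrite !inE => /andP[ik pk].
have : k != j by apply: contraTneq pk => ->; lia.
by rewrite -val_eqE /=; lia.
Qed.

(** An element of the second set missing from the first would complete a pattern 132 with [i] and
    [j]. *)
Lemma avoids132_lehmer_set p i j : avoids132 p -> j = i.+1 :> nat ->
  p i < p j -> #|lehmer_set p i| = #|lehmer_set p j|.
Proof.
move=> /avoids132P av ji lt_p; apply/eqP; rewrite eqn_leq.
rewrite subset_leq_card ?lehmer_set_ascent //=; apply: subset_leq_card.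
apply/subsetP => k; rewrite !inE => /andP[jk pk].
have ne : p k != p i by rewrite (inj_eq perm_inj) -val_eqE /=; lia.
have := av i j k; move: ne; rewrite -val_eqE /=; lia.
Qed.

Lemma avoids132_lehmerP p :
  avoids132 p = tree_node asc_ok (lehmer p).
Proof.
apply/idP/tree_nodeP => [av i|tr].
  rewrite size_lehmer => lt_i; rewrite (nth_lehmer p (Ordinal lt_i)) lehmer_le.
  split=> //; rewrite /asc_ok -nth0 nth_drop addn0.
  (* To the right of the last entry the default head [0] makes the condition hold. *)
  have [lt_i1|ge_i1] := ltnP i.+1 n; last by rewrite nth_default ?size_lehmer.
  rewrite (nth_lehmer p (Ordinal lt_i1)).
  case: (ltngtP (p (Ordinal lt_i)) (p (Ordinal lt_i1))) => [lt_p|lt_p|].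
  - by rewrite [leqRHS](avoids132_lehmer_set (j := Ordinal lt_i1) av).
  - by rewrite ltnW // lehmer_set_descent.
  - by move/val_inj/perm_inj/(congr1 val) => /=; lia.
apply/avoids132P => a b c.
(* The middle position of a pattern is moved left. Either the pattern persists at [b.-1], or [b.-1]
   is an ascent across the value [p c], where the code would increase. *)
have [k] := ubnP b; elim: k a b c => // k IH a b c lt_bk ab bc pac pcb.
have lt_b1 : b.-1 < n by have := ltn_ord b; lia.
pose b' := Ordinal lt_b1; have bb' : b = b'.+1 :> nat by rewrite /=; lia.
have [lt_pc|le_pc] := ltnP (p b') (p c).
  have [|_] := tr b'; first by rewrite size_lehmer.
  rewrite /asc_ok -nth0 nth_drop addn0 -bb' !nth_lehmer leqNgt => /negP; apply.
  apply/proper_card/properP; rewrite lehmer_set_ascent // ?(ltn_trans lt_pc) //.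
  split=> //; exists c; first by rewrite inE bc.
  by rewrite inE negb_and -!leqNgt (ltnW lt_pc) orbT.
have ne : b' != c by rewrite -val_eqE /=; lia.
have ne_p : p b' != p c by rewrite (inj_eq perm_inj).
have ne_a : a != b' by apply: contraTneq pac => ->; lia.
move: ne_p ne_a; rewrite -!val_eqE /= => ne_p ne_a.
by apply: (IH a b' c) => //=; lia.
Qed.

End Lehmer.

Section PA.
Variable m : nat.
Implicit Types (p q : PA m.+1).

Definition PA_word p : seq bool := rev (node_word asc_letter (lehmer p)).

(** The appended [false] stands for the last position, which is never a descent. *)
Lemma rcons_PA_word p :
  rcons (rev (PA_word p)) false = [seq i \in Des p | i <- enum 'I_m.+1].
Proof.
rewrite revK; apply: (@eq_from_nth _ false) => [|i].
  by rewrite size_rcons size_node_word size_map size_lehmer size_enum_ord.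
rewrite size_rcons size_node_word size_lehmer => lt_i.
rewrite (nth_map ord0) ?size_enum_ord // -[i in RHS]/(nat_of_ord (Ordinal lt_i)).
rewrite nth_ord_enum nth_rcons size_node_word size_lehmer inE /=.
case: ltngtP => [lt_im||im].
- rewrite nth_node_word ?size_lehmer // /asc_letter -nth0 nth_drop addn0.
  have lt_i1 : i.+1 < m.+1 by [].
  rewrite (nth_lehmer p (Ordinal lt_i)) (nth_lehmer p (Ordinal lt_i1)).
  have p_av : avoids132 p by exact: (valP p).
  apply/idP/existsP => [lt_c|[j /andP[/eqP ji lt_p]]].
    exists (Ordinal lt_i1); rewrite eqxx ltnNge /=; apply: contraL lt_c.
    rewrite leq_eqVlt => /orP[/eqP/val_inj/perm_inj/(congr1 val) /=|lt_p]; first by lia.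
    by rewrite (avoids132_lehmer_set p_av (j := Ordinal lt_i1)) // ltnn.
  have -> : Ordinal lt_i1 = j by apply: val_inj; rewrite /= ji.
  exact: lehmer_set_descent.
- by lia.
- by apply/esym/existsP => -[j /andP[/eqP ji _]]; have := ltn_ord j; rewrite ji im; lia.
Qed.

Lemma size_PA_word p : size (PA_word p) = m.
Proof. by rewrite size_rev size_node_word size_lehmer. Qed.

Lemma PA_rank_word p : PA_rank p = count id (PA_word p).
Proof.
rewrite -[PA_word p]revK count_rev -[RHS]addn0 -[0]/(count id [:: false]).
rewrite -count_cat cats1 rcons_PA_word count_map /PA_rank cardE -size_filter enumT.
by congr size; apply: eq_filter => x.
Qed.

Lemma card_PA_word w : size w = m -> #|[set p | PA_word p == w]| = ways w 0.
Proof.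
apply: (card_node_word (ok := asc_ok) (state := asc_state)) => //.
- exact: asc_state_children.
- by move=> p q /lehmer_inj/val_inj.
- by move=> p; rewrite size_lehmer -avoids132_lehmerP; split=> //; exact: (valP p).
move=> r szr tr; have [|p rE] := lehmer_surj szr.
  by apply/tree_nodeP => i lt_i; have /tree_nodeP/(_ i lt_i)[] := tr.
have av : avoids132 p by rewrite avoids132_lehmerP rE.
by exists (MkPA av).
Qed.

Lemma all2_implb_rev u v : all2 implb u v -> all2 implb (rev u) (rev v).
Proof.
rewrite !all2E !size_rev => /andP[/eqP szuv]; rewrite szuv eqxx /=.
by rewrite -rev_zip // all_rev.
Qed.

Lemma PA_word_lt p q : word_lt (PA_word p) (PA_word q) -> (p < q)%O.
Proof.
case/andP => ne_pq le_pq; apply: (_ : Des p \proper Des q).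
have := all2_implb_cat (all2_implb_rev le_pq) (all2_implb_refl [:: false]).
rewrite !cats1 !rcons_PA_word => le_Des.
rewrite properEneq; apply/andP; split.
  (* The descent set determines the word, so the inclusion is strict. *)
  apply: contraNneq ne_pq => eq_Des; apply/eqP/(can_inj revK).
  have := rcons_PA_word p; rewrite eq_Des -rcons_PA_word => /eqP.
  by rewrite eqseq_rcons eqxx andbT => /eqP.
apply/subsetP => i ip; move: le_Des; rewrite all2E !size_map eqxx /= zip_map all_map.
by move/allP/(_ i); rewrite mem_enum /= ip => /(_ isT).
Qed.

End PA.

(** * Noncrossing partitions *)

Lemma nest_treeP (L : nat -> nat) n : reflect
  (forall j, j < n -> L j <= j /\ forall t, L j <= t < j -> L j <= L t)
  (tree_node nest_ok (rev (mkseq L n))).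
Proof.
elim: n => [|n IH]; first by left.
rewrite mkseqS rev_rcons /= size_rev size_mkseq.
have nestE : L n <= n -> reflect (forall t, L n <= t < n -> L n <= L t)
    (nest_ok (rev (mkseq L n)) (L n)).
  move=> le_n; rewrite /nest_ok size_rev size_mkseq take_rev size_mkseq subKn // all_rev.
  rewrite /mkseq -map_drop drop_iota add0n all_map; apply: (iffP allP) => H t Ht.
    by apply: H; rewrite mem_iota; lia.
  by apply: H; move: Ht; rewrite mem_iota; lia.
apply: (iffP and3P) => [[le_n /(nestE le_n) okn /IH tr] j|tr].
  by rewrite ltnS leq_eqVlt => /orP[/eqP->|/tr].
have [le_n okn] := tr n ltac:(lia).
split=> //; first exact/nestE.
by apply/IH => j lt_j; apply: tr; lia.
Qed.

Lemma nest_wordE (L : nat -> nat) n :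
  rev (node_word nest_letter (rev (mkseq L n.+1))) = [seq L i < i | i <- iota 1 n].
Proof.
elim: n => // n IH; rewrite -[n.+1 in RHS]addn1 iotaD map_cat cats1 -IH.
rewrite [mkseq L n.+2]mkseqS rev_rcons.
case E : (rev (mkseq L n.+1)) => [|v r].
  by have := size_mkseq L n.+1; rewrite -size_rev E.
rewrite -[LHS]/(rev (nest_letter (v :: r) (L n.+1) :: node_word nest_letter (v :: r))).
by rewrite -E rev_cons /nest_letter size_rev size_mkseq.
Qed.

Section NCA.
Variable m : nat.
Implicit Types (P Q : NCA m.+1) (i j k : 'I_m.+1).

Definition block_min P i : 'I_m.+1 := [arg min_(k < i in pblock P i) (k : nat)].

Lemma NCA_trivIset P : trivIset P.
Proof. by have /andP[/and3P[_ ? _] _] := valP P. Qed.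

Lemma NCA_cover P i : i \in cover P.
Proof. by have /andP[/and3P[/eqP-> _ _] _] := valP P; rewrite in_setT. Qed.

Lemma mem_NCA_pblock P i : i \in pblock P i.
Proof. by rewrite mem_pblock NCA_cover. Qed.

Lemma NCA_pblock_mem P i : pblock P i \in (P : {set _}).
Proof. exact: pblock_mem (NCA_cover P i). Qed.

Lemma block_minP P i : block_min P i \in pblock P i /\
  {in pblock P i, forall k, block_min P i <= k}.
Proof. by rewrite /block_min; case: arg_minnP => [|k]; first exact: mem_NCA_pblock. Qed.

Lemma block_min_le P i : block_min P i <= i.
Proof. by have [_] := block_minP P i; apply; exact: mem_NCA_pblock. Qed.

Lemma eq_block_min P i j :
  (block_min P i == block_min P j) = (pblock P i == pblock P j).
Proof.
have bm k : pblock P (block_min P k) = pblock P k.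
  have [mk _] := block_minP P k.
  by rewrite (same_pblock (NCA_trivIset P) mk).
have min_unique k l : pblock P k = pblock P l -> block_min P k <= block_min P l.
  move=> eq_b; have [mk _] := block_minP P l.
  by have [_] := block_minP P k; apply; rewrite eq_b.
apply/eqP/eqP => [eq_m|eq_b]; first by rewrite -bm eq_m bm.
by apply/val_inj/eqP; rewrite eqn_leq !min_unique.
Qed.

Lemma block_min_idem P i : block_min P (block_min P i) = block_min P i.
Proof.
apply/eqP; rewrite eq_block_min; have [mi _] := block_minP P i.
by rewrite (same_pblock (NCA_trivIset P) mi).
Qed.

(** Otherwise [block_min P i < block_min P j < i < j] would be a crossing of two blocks. *)
Lemma block_min_nest P i j : block_min P j <= i -> i < j ->
  block_min P j <= block_min P i.
Proof.
move=> le_i lt_ij; rewrite leqNgt; apply/negP => lt_m.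
have lt_i : block_min P j < i.
  rewrite ltn_neqAle le_i andbT; apply/eqP => /val_inj eq_i.
  by move: lt_m; rewrite -eq_i block_min_idem ltnn.
have /andP[_ /existsPn/(_ (block_min P i))/existsPn/(_ (block_min P j))] := valP P.
move=> /existsPn/(_ i)/existsPn/(_ j); rewrite lt_m lt_i lt_ij /= => /negP; apply.
have [mi _] := block_minP P i; have [mj _] := block_minP P j.
apply/existsP; exists (pblock P i); rewrite NCA_pblock_mem /=.
apply/existsP; exists (pblock P j); rewrite NCA_pblock_mem /= mi mj !mem_NCA_pblock.
by rewrite -eq_block_min !andbT; apply: contraTneq lt_m => ->; rewrite ltnn.
Qed.

Definition NCA_code P : seq nat :=
  rev (mkseq (fun t => block_min P (inord t) : nat) m.+1).

Definition NCA_word P : seq bool := rev (node_word nest_letter (NCA_code P)).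

Lemma NCA_code_inj : injective NCA_code.
Proof.
move=> P Q /(can_inj revK) eq_c.
have eq_m i : block_min P i = block_min Q i.
  have := congr1 (fun s => nth 0 s i) eq_c.
  by rewrite /= !nth_mkseq // inord_val => /val_inj.
have eq_b i : pblock P i = pblock Q i.
  apply/setP => k.
  rewrite -!eq_pblock ?NCA_trivIset ?NCA_cover //.
  by rewrite -!eq_block_min !eq_m.
have sub (P' Q' : NCA m.+1) : pblock P' =1 pblock Q' ->
    (P' : {set _}) \subset (Q' : {set _}).
  move=> eq_b'; apply/subsetP => B BP.
  have /andP[/and3P[_ _ PN0] _] := valP P'.
  have /set0Pn[x xB] : B != set0 by apply: contraNneq PN0 => <-.
  by rewrite -(def_pblock (NCA_trivIset P') BP xB) eq_b' NCA_pblock_mem.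
by apply/val_inj/eqP; rewrite eqEsubset !sub // => i; rewrite eq_b.
Qed.

Lemma NCA_code_tree P : tree_node nest_ok (NCA_code P).
Proof.
apply/nest_treeP => j lt_j.
have le_m : block_min P (inord j) <= j.
  by rewrite -[leqRHS](inordK lt_j) block_min_le.
split=> // t /andP[le_t lt_t]; have lt_tm := ltn_trans lt_t lt_j.
by apply: block_min_nest; rewrite !inordK.
Qed.

(** The blocks are the fibres of [L]. If [a < b < c < d] with [L a = L c] and [L b = L d], nesting
    for the pairs [c, d] and [b, c] gives [L b <= L a] and [L a <= L b], so the blocks coincide. *)
Lemma NCA_code_surj r : size r = m.+1 -> tree_node nest_ok r ->
  exists P, NCA_code P = r.
Proof.
move=> szr; pose L := nth 0 (rev r).
have rE : r = rev (mkseq L m.+1) by rewrite -szr -size_rev mkseq_nth revK.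
rewrite rE => /nest_treeP tr.
have L_le (i : 'I_m.+1) : L i <= i by have [] := tr i (ltn_ord i).
have L_nest (i j : 'I_m.+1) : L j <= i -> i < j -> L j <= L i.
  by move=> le_i lt_i; have [_] := tr j (ltn_ord j); apply; rewrite le_i.
pose P := preim_partition (fun i : 'I_m.+1 => L i) [set: 'I_m.+1].
have partP : partition P [set: 'I_m.+1] by exact: preim_partitionP.
have memP i k : (k \in pblock P i) = (L i == L k).
  rewrite (@pblock_equivalence_partition _ (fun x y : 'I_m.+1 => L x == L y)) ?inE //.
  by move=> x y z _ _ _; split=> // /eqP->.
have blockP B x y : B \in P -> x \in B -> y \in B -> L x = L y.
  have /and3P[_ tP _] := partP => BP xB yB.
  by apply/eqP; rewrite -memP (def_pblock tP BP xB).
have ncP : noncrossing P.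
  apply/existsPn => a; apply/existsPn => b; apply/existsPn => c; apply/existsPn => d.
  apply/and4P => -[ab bc cd /exists_inP[B BP /exists_inP[C CP]]].
  move=> /and5P[ne_BC aB cB bC dC].
  have eq_ac := blockP _ _ _ BP aB cB; have eq_bd := blockP _ _ _ CP bC dC.
  have le_ba : L b <= L a.
    by rewrite eq_ac eq_bd L_nest // -eq_bd (leq_trans (L_le b)) // ltnW.
  have le_ab : L a <= L b.
    by rewrite eq_ac L_nest // -eq_ac (leq_trans (L_le a)) // ltnW.
  have eq_ab : L a = L b by apply/eqP; rewrite eqn_leq le_ab.
  have /and3P[_ tP _] := partP.
  have : b \in pblock P a by rewrite memP eq_ab.
  rewrite (def_pblock tP BP aB) => bB.
  by case/eqP: ne_BC; rewrite -(def_pblock tP BP bB) (def_pblock tP CP bC).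
have okP : partition P [set: 'I_m.+1] && noncrossing P by rewrite partP.
exists (MkNCA okP); congr rev; apply/eq_in_map => j; rewrite mem_iota add0n.
move=> lt_j; set i := inord j; have iE : j = i :> nat by rewrite inordK.
have [] := block_minP (MkNCA okP) i; rewrite memP => /eqP eq_L min_i.
apply/eqP; rewrite eqn_leq iE eq_L L_le andbT -eq_L.
(* Nesting yields [L (L i) = L i], so [L i] lies in the fibre of [i] and is its minimum. *)
have lt_L : L i < m.+1 by apply: leq_ltn_trans (L_le i) _.
have := min_i (Ordinal lt_L); apply; rewrite memP /=.
rewrite eqn_leq; have := L_le i; rewrite leq_eqVlt => /orP[/eqP eq_Li|lt_Li].
  by rewrite !eq_Li leqnn.
by rewrite (L_nest (Ordinal lt_L) i) // (L_le (Ordinal lt_L)).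
Qed.

Lemma size_NCA_word P : size (NCA_word P) = m.
Proof. by rewrite size_rev size_node_word size_rev size_mkseq. Qed.

Lemma card_NCA_word w : size w = m -> #|[set P | NCA_word P == w]| = ways w 0.
Proof.
apply: (card_node_word (ok := nest_ok) (state := nest_state)) => //.
- exact: nest_state_children.
- exact: NCA_code_inj.
- by move=> P; rewrite size_rev size_mkseq NCA_code_tree.
- exact: NCA_code_surj.
Qed.

Lemma card_NCA_blocks P : #|NCA_blocks P| = #|[set i | block_min P i == i]|.
Proof.
rewrite -(card_in_imset (f := pblock P) (D := mem [set i | block_min P i == i])).
  congr #|pred_of_set _|; apply/setP => B; apply/idP/imsetP => [BP|[i _ ->]].
    have /andP[/and3P[_ _ PN0] _] := valP P.
    have /set0Pn[x xB] : B != set0 by apply: contraNneq PN0 => <-.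
    have [mx _] := block_minP P x.
    exists (block_min P x); first by rewrite !inE block_min_idem.
    by rewrite (same_pblock (NCA_trivIset P) mx) (def_pblock (NCA_trivIset P) BP xB).
  exact: NCA_pblock_mem.
move=> i j; rewrite !inE => /eqP {2}<- /eqP {2}<- /eqP.
by rewrite -eq_block_min => /eqP.
Qed.

Lemma NCA_rank_word P : NCA_rank P = count id (NCA_word P).
Proof.
rewrite /NCA_rank card_NCA_blocks -{1}[m.+1]card_ord -(cardsC [set i | block_min P i == i]).
rewrite addKn /NCA_word nest_wordE count_map.
have -> : ~: [set i | block_min P i == i] = [set i | block_min P i < i].
  by apply/setP => i; rewrite !inE ltn_neqAle block_min_le andbT -val_eqE.
(* The word starts at element [1]; including [0], always a block minimum, changes nothing. *)
transitivity (count (fun t => block_min P (inord t) < t) (iota 0 m.+1)).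
  rewrite -val_enum_ord count_map cardE -size_filter enumT; congr size.
  by apply: eq_filter => i; rewrite /= inE inord_val.
by [].
Qed.

End NCA.

Theorem corollary1 (n : nat) (n_ge1 : 1 <= n) :
  [/\ rank_symmetric (@PA_rank n),
      rank_unimodal (@PA_rank n),
      strongly_Sperner (@PA_rank n)
    & rank_gen_fun (@PA_rank n) = rank_gen_fun (@NCA_rank n)].
Proof.
case: n n_ge1 => // m _.
have max_PA := word_max_rank (@size_PA_word m) (@card_PA_word m) (@PA_rank_word m).
have max_NCA := word_max_rank (@size_NCA_word m) (@card_NCA_word m) (@NCA_rank_word m).
have [cs cs_enum cs_chain] := ex_symchains (@size_PA_word m) (@card_PA_word m)
  (@PA_rank_word m) (@PA_word_lt m).
have rk_lt (p q : PA m.+1) : (p < q)%O -> PA_rank p < PA_rank q.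
  by move=> lt_pq; apply: proper_card; exact: lt_pq.
split.
- exact: symchains_rank_symmetric max_PA cs_enum cs_chain.
- exact: symchains_rank_unimodal max_PA cs_enum cs_chain.
- exact: symchains_strongly_Sperner rk_lt max_PA cs_enum cs_chain.
(* Both families of rank sizes are the same sums of [ways] over words of length [m]. *)
rewrite /rank_gen_fun max_PA max_NCA; apply: eq_bigr => k _.
rewrite (word_rank_size (@size_PA_word m) (@card_PA_word m) (@PA_rank_word m)).
by rewrite (word_rank_size (@size_NCA_word m) (@card_NCA_word m) (@NCA_rank_word m)).
Qed.
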